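(* Let $K$ be a compact line, and let $G: K \to \mathbb{R}$ be a nondecreasing, positive, and amenable function. Consider a sequence $(f_m)_{m \in \mathbb{N}}$ of $G$-integrable functions $f_m: K \to \mathbb{R}$ such that $g\leq f_m \leq h$ for every $m \in \mathbb{N}$, where $g,h:K\to\mathbb R$ are $G$-integrable functions. If $(f_m)_m$ converges pointwise to a function $f:K\to\mathbb R$, then $f$ is $G$-integrable and \[\lim_{m\to \infty} \int_K f_m \, dG = \int_K f \, dG.\]
   Context: A compact line is a nonempty linearly ordered set $K$ whose order topology is compact; $0_K$ and $1_K$ denote its least and greatest elements (they exist), and intervals are written as usual, e.g. $(x,y]=\{z\in K: x<z\le y\}$. An open interval of $K$ is an interval that is an open subset of $K$. Integral. A partition of $K$ is $P=\{([x_{i-1},x_i],t_i):1\le i\le n\}$ with $0_K=x_0\le x_1\le\dots\le x_n=1_K$ in $K$ and $t_i\in[x_{i-1},x_i]$. A gauge on $K$ is a function $\delta$ assigning to each $x\in K$ an open interval $\delta(x)$ of $K$ with $x\in\delta(x)$. $P$ is $\delta$-fine, written $P\ll\delta$, if $(x_{i-1},x_i]\subset\delta(t_i)$ for all $i$. For $f,G:K\to\mathbb R$ set $S(f,G,P)=f(0_K)G(0_K)+\sum_{i=1}^n f(t_i)(G(x_i)-G(x_{i-1}))$. The function $f$ is $G$-integrable, with integral $\int_K f\,dG=A\in\mathbb R$, if for each $\varepsilon>0$ there is a gauge $\delta$ on $K$ such that $|S(f,G,P)-A|<\varepsilon$ for every $P\ll\delta$. A point $x\in[0_K,1_K)$ is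 right-dense if every neighborhood of $x$ contains a point greater than $x$; $x\in(0_K,1_K]$ is left-dense if every neighborhood of $x$ contains a point less than $x$. A function $G:K\to\mathbb R$ is amenable if it is right-continuous (at each $x\in[0_K,1_K)$, for every $\varepsilon>0$ there is a neighborhood $V$ of $x$ with $|G(y)-G(x)|<\varepsilon$ for $y\in V\cap[x,1_K]$) and regulated (the left-hand limit exists in $\mathbb R$ at every left-dense point and the right-hand limit exists in $\mathbb R$ at every right-dense point). *)

(* Defs.v *)
From HB Require Import structures.
From mathcomp Require Import all_boot all_order all_algebra finmap.
From mathcomp Require Import all_classical all_reals all_analysis.

Set Implicit Arguments.
Unset Strict Implicit.
Unset Printing Implicit Defensive.

Import Order.TTheory GRing.Theory Num.Theory.
Import numFieldNormedType.Exports.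

Local Open Scope classical_set_scope.
Local Open Scope ring_scope.

HB.mixin Record isCompactLine d T & OrderTopological d T := {
  line_nonempty : [set: T] !=set0;
  line_compact : compact [set: T]
}.

#[short(type="compactLineType")]
HB.structure Definition CompactLine d :=
  { T of OrderTopological d T & isCompactLine d T }.

Section Endpoints.
Context {d : Order.disp_t} {K : compactLineType d}.
Local Open Scope order_scope.

(* [compact_cover] is stated for pointed types only. *)
Lemma line_cover_compact : cover_compact [set: K].
Proof.
have [x0 _] := @line_nonempty d K.
pose K' : ptopologicalType :=
  HB.pack (CompactLine.sort K) (isPointed.Build (CompactLine.sort K) x0).
suff : @cover_compact K' [set: K'] by [].
by rewrite -(compact_cover K'); exact: (@line_compact d K).
Qed.

Lemma line_has_least : exists z : K, forall x : K, z <= x.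
Proof.
apply: contrapT => nz.
have H (x : K) : exists y, y < x.
  apply: contrapT => nx; apply: nz; exists x => y.
  by rewrite leNgt; apply/negP => yx; apply: nx; exists y.
have := line_cover_compact.
move=> /(_ K setT (fun y => [set` `]y, +oo[])) [].
- by move=> y _; exact: rray_open.
- by move=> x _; have [y yx] := H x; exists y => //=; rewrite in_itv/= yx.
move=> D' _ cov.
have [x0 _] := @line_nonempty d K.
have [m mP] : exists m : K, forall y, y \in (D' : seq K) -> m <= y.
  elim: (D' : seq K) => [|a s [m IH]]; first by exists x0.
  exists (Order.min a m) => y; rewrite in_cons => /orP[/eqP->|/IH ys].
    by rewrite ge_min lexx.
  by rewrite ge_min ys orbT.
have [y /= yD] := cov m I; rewrite in_itv/= andbT => ym.
by have := mP y yD; rewrite leNgt ym.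
Qed.

Lemma line_has_greatest : exists z : K, forall x : K, x <= z.
Proof.
apply: contrapT => nz.
have H (x : K) : exists y, x < y.
  apply: contrapT => nx; apply: nz; exists x => y.
  by rewrite leNgt; apply/negP => yx; apply: nx; exists y.
have := line_cover_compact.
move=> /(_ K setT (fun y => [set` `]-oo, y[])) [].
- by move=> y _; exact: lray_open.
- by move=> x _; have [y yx] := H x; exists y => //=; rewrite in_itv/= yx.
move=> D' _ cov.
have [x0 _] := @line_nonempty d K.
have [m mP] : exists m : K, forall y, y \in (D' : seq K) -> y <= m.
  elim: (D' : seq K) => [|a s [m IH]]; first by exists x0.
  exists (Order.max a m) => y; rewrite in_cons => /orP[/eqP->|/IH ys].
    by rewrite le_max lexx.
  by rewrite le_max ys orbT.
have [y /= yD] := cov m I; rewrite in_itv/= => ym.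
by have := mP y yD; rewrite leNgt ym.
Qed.

Definition line_min : K := sval (cid line_has_least).
Definition line_max : K := sval (cid line_has_greatest).

Lemma line_min_le (x : K) : line_min <= x.
Proof. exact: (svalP (cid line_has_least)). Qed.

Lemma line_max_ge (x : K) : x <= line_max.
Proof. exact: (svalP (cid line_has_greatest)). Qed.

End Endpoints.
Arguments line_min {d} K.
Arguments line_max {d} K.

Section Integral.
Context {R : realType} {d : Order.disp_t} {K : compactLineType d}.
Implicit Types (f G : K -> R).

(* Only the values [div_pt i], i <= size_part, and [tag i], i < size_part, are
   meaningful.  The tag of the cell [x_i, x_{i+1}] is [tag i], so tags are
   numbered from 0.  [size_part = 0] is possible only when K is a singleton. *)
Record line_partition := LinePartition {
  size_part : nat;
  div_pt : nat -> K;
  tag : nat -> K;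
  div_pt_first : div_pt 0%N = line_min K;
  div_pt_last : div_pt size_part = line_max K;
  div_pt_tag : forall i, (i < size_part)%N ->
    (div_pt i <= tag i)%O /\ (tag i <= div_pt i.+1)%O
}.

Definition is_gauge (delta : K -> interval K) : Prop :=
  forall x, open [set` delta x] /\ x \in delta x.

Definition fine_partition (delta : K -> interval K) (P : line_partition) :
    Prop :=
  forall i, (i < size_part P)%N ->
    [set` `]div_pt P i, div_pt P i.+1]] `<=` [set` delta (tag P i)].

Definition riemann_sum f G (P : line_partition) : R :=
  f (line_min K) * G (line_min K) +
  \sum_(i < size_part P) f (tag P i) * (G (div_pt P i.+1) - G (div_pt P i)).

Definition is_line_integral f G (A : R) : Prop :=
  forall e : R, 0 < e -> exists2 delta : K -> interval K, is_gauge delta &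
    forall P, fine_partition delta P -> `|riemann_sum f G P - A| < e.

Definition line_integrable f G : Prop := exists A, is_line_integral f G A.

(* A junk value when f is not G-integrable. *)
Definition line_integral f G : R := get [set A | is_line_integral f G A].

End Integral.

Section Amenable.
Context {R : realType} {d : Order.disp_t} {K : compactLineType d}.
Local Open Scope order_scope.

Definition right_dense (x : K) : Prop :=
  x < line_max K /\ forall V, nbhs x V -> exists2 y, V y & x < y.

Definition left_dense (x : K) : Prop :=
  line_min K < x /\ forall V, nbhs x V -> exists2 y, V y & y < x.

Definition line_right_continuous (G : K -> R) : Prop :=
  forall x, x < line_max K ->
    G y @[y --> within [set y | x <= y] (nbhs x)] --> G x.

Definition regulated (G : K -> R) : Prop :=
  (forall x, left_dense x ->
     exists l : R, G y @[y --> within [set y | y < x] (nbhs x)] --> l) /\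
  (forall x, right_dense x ->
     exists l : R, G y @[y --> within [set y | x < y] (nbhs x)] --> l).

Definition amenable (G : K -> R) : Prop :=
  line_right_continuous G /\ regulated G.

End Amenable.

(* Main.v *)
(* Two facts about sums over fine partitions replace measure theory.

   (1) Countable subadditivity: if [w_k >= 0] is integrable with gauge [D_k],
   take at [t] the intersection of only those [D_k] with [k < N t].  The cells
   of a fine partition with [k < N t] extend, by Cousin's lemma on the gaps, to
   a [D_k]-fine partition, so they contribute at most [int w_k + e / 2 ^ k].
   Applied to the increments of a monotone sequence this gives monotone
   convergence, without the Saks-Henstock lemma.

   (2) If [w] is integrable and below an integrable [h >= 0], then [w^+] is
   integrable.  For a partition [p] almost maximizing the sum of [w^+], and any
   finer [q], exchange [p] for [q] on the cells where [w > 0] at the tag of [p];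
   the sum of [w] hardly changes, so the sum of [w^+] over [q] is also almost
   maximal.  Hence minima of nonnegative integrable functions are integrable.

   Together they give Fatou's lemma for dominated nonnegative sequences, and
   dominated convergence follows by applying it to [f_m - g] and [h - f_m]. *)

Require Import Defs.
From HB Require Import structures.
From mathcomp Require Import all_boot all_order all_algebra.
From mathcomp Require Import all_classical all_reals all_analysis.
From mathcomp Require Import ring lra zify.

Set Implicit Arguments.
Unset Strict Implicit.
Unset Printing Implicit Defensive.

Import Order.TTheory GRing.Theory Num.Theory.
Import numFieldNormedType.Exports.

Local Open Scope classical_set_scope.
Local Open Scope ring_scope.

(** * Fine chains and Cousin's lemma *)

Section Chains.
Context {d : Order.disp_t} {K : compactLineType d}.
Implicit Types (a b c x y z t : K) (D : K -> set K) (s : seq (K * K)).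

Lemma itv_convex (i : interval K) x y z :
  x \in i -> y \in i -> (x <= z)%O -> (z <= y)%O -> z \in i.
Proof.
case: i => l u; rewrite !itv_boundlr => /andP[lx _] /andP[_ yu] xz zy.
by rewrite (le_trans lx) ?bnd_simp// (le_trans _ yu)// bnd_simp.
Qed.

Lemma nbhs_open_itv x (V : set K) : nbhs x V ->
  exists2 i : interval K, open [set` i] /\ x \in i & [set` i] `<=` V.
Proof.
rewrite itv_nbhsE => -[i [oi xi] iV]; exists i => //.
by split=> //; exact: itv_open_ends_open.
Qed.

(** Compactness gives a cluster point of the filter of tails of [S] along [r]. With [<=] it serves
    as the supremum of [S], with [>=] as the infimum. *)
Lemma cofinal_cluster (r : rel K) (S : set K) :
  total r -> transitive r -> S !=set0 ->
  exists p : K, forall x (V : set K), S x -> nbhs p V ->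
    exists y, [/\ S y, r x y & V y].
Proof.
move=> rtot rtr [x0 Sx0].
have rxx x : r x x by have := rtot x x; rewrite orbb.
pose F := filter_from S (fun x => [set y | S y /\ r x y]).
have FF : ProperFilter F.
  apply: filter_from_proper; last by move=> x Sx; exists x.
  apply: filter_from_filter; first by exists x0.
  move=> x y Sx Sy; have /orP[xy|yx] := rtot x y.
  - by exists y => // z [Sz yz]; do !split=> //; exact: rtr yz.
  - by exists x => // z [Sz yz]; do !split=> //; exact: rtr yz.
have [p [_ pF]] := @line_compact d K F FF filterT.
exists p => x V Sx pV.
have [|y [[Sy xy] Vy]] := pF [set y | S y /\ r x y] V _ pV; first by exists x.
by exists y.
Qed.

(* A pair [(t, x)] in a chain is the cell with tag [t] and right endpoint [x];
   its left endpoint is the right endpoint of the preceding cell. *)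
Fixpoint fine_chain D a s b : Prop :=
  if s is (t, x) :: s' then
    [/\ (a <= t)%O, (t <= x)%O, [set` `]a, x]] `<=` D t & fine_chain D x s' b]
  else a = b.

Lemma fine_chain_le D a s b : fine_chain D a s b -> (a <= b)%O.
Proof.
elim: s a => [|[t x] s IH] a /=; first by move->.
by case=> at_ tx _ /IH; apply: le_trans; exact: le_trans at_ tx.
Qed.

Lemma fine_chain_cat D a s1 b s2 c :
  fine_chain D a s1 b -> fine_chain D b s2 c -> fine_chain D a (s1 ++ s2) c.
Proof.
elim: s1 a => [|[t x] s IH] a /=; first by move->.
by case=> at_ tx tD /IH sb /sb.
Qed.

Lemma fine_chain_sub D1 D2 a s b : (forall x, D1 x `<=` D2 x) ->
  fine_chain D1 a s b -> fine_chain D2 a s b.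
Proof.
move=> D12; elim: s a => [|[t x] s IH] a //= [at_ tx tD /IH sb].
by split=> //; apply: subset_trans tD (D12 t).
Qed.

(** Arbitrary neighbourhoods instead of open intervals let gauges be intersected freely;
    [nbhs_open_itv] recovers intervals. *)
Definition nbhs_gauge D := forall x, nbhs x (D x).

Lemma nbhs_gaugeI D1 D2 : nbhs_gauge D1 -> nbhs_gauge D2 ->
  nbhs_gauge (fun x => D1 x `&` D2 x).
Proof. by move=> g1 g2 x; exact: filterI. Qed.

(** The supremum [p] of the points reachable from [a] is itself reachable, by a cell tagged [p]; if
    [p < b], one more cell goes beyond [p], a contradiction. *)
Lemma cousin D a b : nbhs_gauge D -> (a <= b)%O -> exists s, fine_chain D a s b.
Proof.
move=> gD ab.
pose S := [set x | (x <= b)%O /\ exists s, fine_chain D a s x].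
have Sa : S a by split=> //; exists [::].
have Sstep x y t : S x -> (x <= t)%O -> (t <= y)%O -> (y <= b)%O ->
    [set` `]x, y]] `<=` D t -> S y.
  move=> [xb [s sx]] xt ty yb xyD; split=> //; exists (s ++ [:: (t, y)]).
  by apply: fine_chain_cat sx _.
have [|||p pP] := @cofinal_cluster <=%O S; [exact: le_total|exact: le_trans|by exists a|].
have pub x : S x -> (x <= p)%O.
  move=> Sx; rewrite leNgt; apply/negP => px.
  have [|y [_ xy]] := pP x [set` `]-oo, x[] Sx.
    by apply: open_nbhs_nbhs; split; [exact: lray_open|rewrite /= in_itv].
  by rewrite /= in_itv/= ltNge xy.
have [i [oi pi] iD] := nbhs_open_itv (gD p).
have ip : nbhs p [set` i] by exact: open_nbhs_nbhs.
have [x [Sx _ xi]] := pP a _ Sa ip.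
have xp := pub _ Sx.
have pb : (p <= b)%O.
  rewrite leNgt; apply/negP => bp.
  have [|y [[yb _] _]] := pP a [set` `]b, +oo[] Sa.
    by apply: open_nbhs_nbhs; split; [exact: rray_open|rewrite /= in_itv/= bp].
  by rewrite /= in_itv/= andbT ltNge yb.
have Sp : S p.
  apply: (Sstep x p p) => // z /=; rewrite in_itv/= => /andP[/ltW xz zp].
  by apply: iD; exact: itv_convex xi pi xz zp.
have [->|pneb] := eqVneq b p; first by case: Sp.
have {}pb : (p < b)%O by rewrite lt_neqAle pb andbT eq_sym.
pose U := [set y | (p < y)%O].
have [|||q qP] := @cofinal_cluster >=%O U.
- by move=> y z; exact: le_total.
- by move=> y z w /= zy wz; exact: le_trans wz zy.
- by exists b.
have qlb y : (p < y)%O -> (q <= y)%O.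
  move=> py; rewrite leNgt; apply/negP => yq.
  have [|z [_ yz]] := qP y [set` `]y, +oo[] py.
    by apply: open_nbhs_nbhs; split; [exact: rray_open|rewrite /= in_itv/= yq].
  by rewrite /= in_itv/= andbT => /(le_lt_trans yz); rewrite ltxx.
(* If [p < q], then [q] is the successor of [p] and the cell []p, q]], reduced to [q], takes the tag
   [q]. Otherwise [q = p], points above [p] occur in [i], and the tag is [p]. *)
have [y [Sy py]] : exists y, S y /\ (p < y)%O.
  have [pq|qp] := ltP p q.
    exists q; split => //; apply: (Sstep p q q) => //; first exact: ltW.
      exact: qlb.
    move=> z /=; rewrite in_itv/= => /andP[/qlb qz zq].
    have -> : z = q by apply/le_anti; rewrite qz zq.
    exact: nbhs_singleton.
  have qi : nbhs q [set` i].
    apply: open_nbhs_nbhs; split=> //=.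
    suff -> : q = p by [].
    apply/le_anti; rewrite qp leNgt; apply/negP => qp'.
    have [|z [pz _]] := qP b [set` `]-oo, p[] pb.
      by apply: open_nbhs_nbhs; split; [exact: lray_open|rewrite /= in_itv].
    by rewrite /= in_itv/= ltNge (ltW pz).
  have [y [py yb yi]] := qP b _ pb qi.
  exists y; split=> //; apply: (Sstep p y p) => //; first exact: ltW.
  move=> z /=; rewrite in_itv/= => /andP[/ltW pz zy].
  by apply: iD; exact: itv_convex pi yi pz zy.
by have := pub _ Sy; rewrite leNgt py.
Qed.

End Chains.

(** * Sums over chains: cutting, exchanging and extending *)

Section ChainSums.
Context {R : realType} {d : Order.disp_t} {K : compactLineType d}.
Variable G : K -> R.
Implicit Types (a b c x y z t : K) (D : K -> set K) (s : seq (K * K)).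
Implicit Types (u v w f : K -> R).

Fixpoint chain_sum f a s : R :=
  if s is (t, x) :: s' then f t * (G x - G a) + chain_sum f x s' else 0.

Lemma chain_sum_cat f D a s1 b s2 : fine_chain D a s1 b ->
  chain_sum f a (s1 ++ s2) = chain_sum f a s1 + chain_sum f b s2.
Proof.
elim: s1 a => [|[t x] s IH] a /=; first by move->; rewrite add0r.
by case=> _ _ _ /IH ->; rewrite addrA.
Qed.

Lemma chain_sumD u v a s :
  chain_sum (fun x => u x + v x) a s = chain_sum u a s + chain_sum v a s.
Proof. by elim: s a => [|[t x] s IH] a /=; rewrite ?addr0// IH; ring. Qed.

Lemma chain_sumB u v a s :
  chain_sum (fun x => u x - v x) a s = chain_sum u a s - chain_sum v a s.
Proof. by elim: s a => [|[t x] s IH] a /=; rewrite ?subr0// IH; ring. Qed.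

Lemma chain_sum_sum n (F : 'I_n -> K -> R) a s :
  chain_sum (fun x => \sum_(k < n) F k x) a s =
  \sum_(k < n) chain_sum (F k) a s.
Proof.
elim: s a => [|[t x] s IH] a /=; first by rewrite big1.
by rewrite IH mulr_suml -big_split.
Qed.

Lemma chain_sum_cst k D a s b : fine_chain D a s b ->
  chain_sum (fun=> k) a s = k * (G b - G a).
Proof.
elim: s a => [|[t x] s IH] a /=; first by move->; rewrite subrr mulr0.
by case=> _ _ _ /IH ->; ring.
Qed.

(* A gauge that forces [c] to be the tag of any cell containing it amounts to
   making [c] a division point, since a cell may be cut at its tag. *)
Lemma fine_chain_split D a s b c : (forall t, D t c -> t = c) ->
  (a <= c)%O -> (c <= b)%O -> fine_chain D a s b ->
  exists s1 s2, [/\ fine_chain D a s1 c, fine_chain D c s2 b &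
    forall f, chain_sum f a s = chain_sum f a s1 + chain_sum f c s2].
Proof.
move=> Dc; elim: s a => [|[t x] s IH] a /=.
  move=> ac cb ab; have {ab ac cb} [-> ->] : a = c /\ b = c.
    by subst b; split; apply/le_anti; rewrite ac cb.
  by exists [::], [::]; split=> //= f; rewrite addr0.
move=> ac cb [at_ tx axD sb].
have [xc|cx] := leP x c.
  have [s1 [s2 [s1c s2b ss]]] := IH _ xc cb sb.
  exists ((t, x) :: s1), s2; split=> // f /=.
  by rewrite ss addrA.
have [eac|nac] := eqVneq a c.
  exists [::], ((t, x) :: s); rewrite -eac; split=> // f /=.
  by rewrite add0r.
have {}ac : (a < c)%O by rewrite lt_neqAle nac.
have tc : t = c by apply/Dc/axD; rewrite /= in_itv/= ac ltW.
subst t; exists [:: (c, c)], ((c, x) :: s); split=> [|| f /=].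
- split=> //; apply: subset_trans axD => z /=.
  by rewrite !in_itv/= => /andP[-> /le_trans zc]; exact: zc.
- split=> //; apply: subset_trans axD => z /=.
  by rewrite !in_itv/= => /andP[/(lt_trans ac) -> ->].
- by ring.
Qed.

(** Rays separate distinct points. This gauge supplies the hypothesis of [fine_chain_split] at every
    point of [l]. *)
Lemma avoid_nbhs_gauge (l : seq K) :
  nbhs_gauge (fun t => [set y | y \in l -> t = y]).
Proof.
move=> t; elim: l => [|c l IH].
  by apply: filterS filterT => y _ /=; rewrite in_nil.
have Hc : nbhs t [set y | y = c -> t = y].
  have [tc|ct|->] := ltgtP t c.
  - have : nbhs t [set` `]-oo, c[].
      by apply: open_nbhs_nbhs; split; [exact: lray_open|rewrite /= in_itv].
    by apply: filterS => y /= + yc; rewrite yc in_itv/= ltxx.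
  - have : nbhs t [set` `]c, +oo[].
      by apply: open_nbhs_nbhs; split; [exact: rray_open|rewrite /= in_itv/= ct].
    by apply: filterS => y /= + yc; rewrite yc in_itv/= ltxx.
  - by apply: filterS filterT => y _ ->.
apply: filterS (filterI Hc IH) => y [/= yc yl].
by rewrite in_cons => /orP[/eqP/yc|/yl].
Qed.

Hypothesis G_nd : forall x y, (x <= y)%O -> G x <= G y.

Lemma chain_sum_le u v D a s b : fine_chain D a s b ->
  (forall e, e \in s -> u e.1 <= v e.1) -> chain_sum u a s <= chain_sum v a s.
Proof.
elim: s a => [|[t x] s IH] a //= [at_ tx _ sb] uv.
apply: lerD; last by apply: IH => // e es; apply: uv; rewrite in_cons es orbT.
apply: ler_wpM2r; first by rewrite subr_ge0 G_nd// (le_trans at_).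
by apply: (uv (t, x)); rewrite mem_head.
Qed.

Lemma chain_sum_ge0 u D a s b : fine_chain D a s b ->
  (forall x, 0 <= u x) -> 0 <= chain_sum u a s.
Proof.
move=> sb u0; have <- : chain_sum (fun=> 0) a s = 0.
  by rewrite (chain_sum_cst _ sb) mul0r.
by apply: chain_sum_le sb _ => e _.
Qed.

(* The chain [r] follows [q] inside the cells of [p] whose tag satisfies
   [0 < w], and follows [p] elsewhere. *)
Lemma chain_sum_pospart_exchange D D' w a p b q :
  (forall t, D' t `<=` D t) ->
  (forall e, e \in p -> forall t, D' t e.2 -> t = e.2) ->
  fine_chain D a p b -> fine_chain D' a q b ->
  exists2 r, fine_chain D a r b &
    chain_sum w a r - chain_sum w a p <=
    chain_sum (fun x => Num.max (w x) 0) a q -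
    chain_sum (fun x => Num.max (w x) 0) a p.
Proof.
move=> D'D; elim: p a q => [|[t x] p IH] a q pD' /=.
  move=> <- qa; exists [::] => //=.
  rewrite !subr0; apply: chain_sum_ge0 qa _ => z.
  by rewrite le_max lexx orbT.
move=> [at_ tx axD pb] qb.
have pD'x : forall t, D' t x -> t = x by apply: (pD' (t, x)); rewrite mem_head.
have [|q1 [q2 [q1x q2b qE]]] := fine_chain_split pD'x _ (fine_chain_le pb) qb.
  exact: le_trans tx.
have [e ep|r rb rle] := IH x q2 _ pb q2b.
  by apply: pD'; rewrite in_cons ep orbT.
(* If [w t <= 0] the cell is kept: the positive part vanishes at [t], while [q1] contributes at
   least 0. *)
have [w0|w0] := lerP (w t) 0.
  exists ((t, x) :: r) => //=.
  have : 0 <= chain_sum (fun x => Num.max (w x) 0) a q1.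
    by apply: chain_sum_ge0 q1x _ => z; rewrite le_max lexx orbT.
  by rewrite qE; lra.
(* If [0 < w t], the cell contributes equally to both sums over [p], and [w] is below its positive
   part along [q1]. *)
exists (q1 ++ r).
  by apply: fine_chain_cat rb; exact: fine_chain_sub q1x.
have : chain_sum w a q1 <= chain_sum (fun x => Num.max (w x) 0) a q1.
  by apply: chain_sum_le q1x _ => e _; rewrite le_max lexx.
by rewrite (chain_sum_cat _ _ q1x) qE; lra.
Qed.

(** Cells with tag outside [Q] add 0 on the left, so Cousin's lemma may replace each by a [D']-fine
    chain, whose sum is nonnegative. *)
Lemma chain_sum_extend D D' (Q : pred K) w a s b :
  nbhs_gauge D' -> (forall t, Q t -> D t `<=` D' t) -> (forall x, 0 <= w x) ->
  fine_chain D a s b ->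
  exists2 s', fine_chain D' a s' b &
    chain_sum (fun x => if Q x then w x else 0) a s <= chain_sum w a s'.
Proof.
move=> gD' DD' w0; elim: s a => [|[t x] s IH] a /=.
  by move=> <-; exists [::].
move=> [at_ tx axD /IH[s' s'b s'le]].
have [Qt|nQt] := boolP (Q t).
  exists ((t, x) :: s') => /=; last by rewrite lerD2l.
  by split=> //; exact: subset_trans axD (DD' _ Qt).
have [s1 s1x] := cousin gD' (le_trans at_ tx).
exists (s1 ++ s'); first exact: fine_chain_cat s1x s'b.
rewrite (chain_sum_cat _ _ s1x) mul0r.
by apply: lerD => //; exact: chain_sum_ge0 s1x w0.
Qed.

(** * The integral: comparison, linearity, Cauchy criterion *)

(* The term [f 0_K * G 0_K] of Riemann sums is left out. *)
Definition chain_integral f (A : R) := forall e, 0 < e ->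
  exists2 D, nbhs_gauge D & forall s, fine_chain D (line_min K) s (line_max K) ->
    `|chain_sum f (line_min K) s - A| < e.

Lemma full_chain D : nbhs_gauge D ->
  exists s, fine_chain D (line_min K) s (line_max K).
Proof. by move=> gD; apply: cousin gD _; exact: line_min_le. Qed.

Lemma chain_integral_le u v A B : chain_integral u A -> chain_integral v B ->
  (forall x, u x <= v x) -> A <= B.
Proof.
move=> uA vB uv; apply/ler_addgt0Pr => e e0.
have e2 : 0 < e / 2 by lra.
have [D1 g1 P1] := uA _ e2; have [D2 g2 P2] := vB _ e2.
have [s sD] := full_chain (nbhs_gaugeI g1 g2).
have := P1 s (fine_chain_sub (fun x => @subIsetl _ _ _) sD).
have := P2 s (fine_chain_sub (fun x => @subIsetr _ _ _) sD).
have : chain_sum u (line_min K) s <= chain_sum v (line_min K) s.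
  by apply: chain_sum_le sD _.
by rewrite !ltr_norml => ? /andP[? ?] /andP[? ?]; lra.
Qed.

Lemma chain_integral_unique u A B :
  chain_integral u A -> chain_integral u B -> A = B.
Proof.
move=> uA uB; apply/le_anti.
by rewrite (chain_integral_le uA uB)// (chain_integral_le uB uA).
Qed.

Lemma chain_integralB u v A B : chain_integral u A -> chain_integral v B ->
  chain_integral (fun x => u x - v x) (A - B).
Proof.
move=> uA vB e e0.
have e2 : 0 < e / 2 by lra.
have [D1 g1 P1] := uA _ e2; have [D2 g2 P2] := vB _ e2.
exists (fun x => D1 x `&` D2 x); first exact: nbhs_gaugeI.
move=> s sD; rewrite chain_sumB.
have := P1 s (fine_chain_sub (fun x => @subIsetl _ _ _) sD).
have := P2 s (fine_chain_sub (fun x => @subIsetr _ _ _) sD).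
by rewrite !ltr_norml => /andP[? ?] /andP[? ?]; lra.
Qed.

Lemma chain_integral0 : chain_integral (fun=> 0) 0.
Proof.
move=> e e0; exists (fun=> setT); first by move=> x; exact: filterT.
by move=> s sD; rewrite (chain_sum_cst _ sD) mul0r subrr normr0.
Qed.

Lemma chain_integralN u A : chain_integral u A ->
  chain_integral (fun x => - u x) (- A).
Proof.
move=> uA; rewrite -sub0r (_ : (fun x => - u x) = (fun x => 0 - u x)).
  exact: chain_integralB chain_integral0 uA.
by apply/funext => x; rewrite sub0r.
Qed.

(** The limit is the lower integral, the supremum of the eventual lower bounds of the sums. *)
Lemma chain_integral_cauchy u :
  (forall e, 0 < e -> exists c : R, exists2 D, nbhs_gauge D &
    forall s, fine_chain D (line_min K) s (line_max K) ->
      `|chain_sum u (line_min K) s - c| <= e) ->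
  exists A, chain_integral u A.
Proof.
move=> uC.
pose E := [set y | exists2 D, nbhs_gauge D &
  forall s, fine_chain D (line_min K) s (line_max K) ->
    y <= chain_sum u (line_min K) s].
have EB e (c : R) D : nbhs_gauge D -> (forall s,
    fine_chain D (line_min K) s (line_max K) ->
    `|chain_sum u (line_min K) s - c| <= e) -> E (c - e) /\ ubound E (c + e).
  move=> gD Dc; split.
    by exists D => // s /Dc; rewrite ler_norml => /andP[? ?]; lra.
  move=> y [D' gD' D'y].
  have [s sD] := full_chain (nbhs_gaugeI gD gD').
  have := Dc s (fine_chain_sub (fun x => @subIsetl _ _ _) sD).
  have := D'y s (fine_chain_sub (fun x => @subIsetr _ _ _) sD).
  by rewrite ler_norml => ? /andP[? ?]; lra.
exists (sup E) => e e0; have e3 : 0 < e / 3 by lra.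
have [c [D gD Dc]] := uC _ e3; have [Ec cE] := EB _ _ _ gD Dc.
have lb : c - e / 3 <= sup E by apply: ub_le_sup => //; exists (c + e / 3).
have ub : sup E <= c + e / 3 by apply: ge_sup => //; exists (c - e / 3).
exists D => // s /Dc; rewrite ler_norml ltr_norml => /andP[? ?].
by apply/andP; split; lra.
Qed.

(** * Positive parts and minima *)

Lemma chain_integral_pospart w h A B : chain_integral w A ->
  chain_integral h B -> (forall x, w x <= h x) -> (forall x, 0 <= h x) ->
  exists C, chain_integral (fun x => Num.max (w x) 0) C.
Proof.
move=> wA hB wh h0; apply: chain_integral_cauchy => e e0.
have e3 : 0 < e / 3 by lra.
have [D1 g1 P1] := wA _ e3; have [D2 g2 P2] := hB _ ltr01.
pose D := fun x => D1 x `&` D2 x.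
have gD : nbhs_gauge D by exact: nbhs_gaugeI.
pose E := [set y | exists2 s, fine_chain D (line_min K) s (line_max K) &
  y = chain_sum (fun x => Num.max (w x) 0) (line_min K) s].
have Eub : has_ubound E.
  exists (B + 1) => y [s sD ->].
  have := P2 s (fine_chain_sub (fun x => @subIsetr _ _ _) sD).
  have : chain_sum (fun x => Num.max (w x) 0) (line_min K) s <=
         chain_sum h (line_min K) s.
    by apply: chain_sum_le sD _ => z _; rewrite ge_max wh h0.
  by rewrite ltr_norml => ? /andP[? ?]; lra.
have Esup : has_sup E.
  split=> //; have [s sD] := full_chain gD.
  by exists (chain_sum (fun x => Num.max (w x) 0) (line_min K) s), s.
have [_ [p pD ->] psup] := sup_adherent e3 Esup.
(* Under [D'], a cell containing a division point of [p] has it as tag, so [q] can be cut along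
   [p]. *)
pose D' t := D t `&` [set y | y \in map snd p -> t = y].
exists (sup E), D'.
  by apply: nbhs_gaugeI gD _; exact: avoid_nbhs_gauge.
move=> q qD'.
have qle : chain_sum (fun x => Num.max (w x) 0) (line_min K) q <= sup E.
  apply: ub_le_sup => //; exists q => //.
  exact: fine_chain_sub (fun x => @subIsetl _ _ _) qD'.
have [|e' e'p t [_]|r rD rle] := chain_sum_pospart_exchange (D' := D') w _ _ pD qD'.
- by move=> t y [].
- by apply; exact: map_f.
(* The sums of [w] over [r] and [p] are within [e / 3] of [A], and [p] misses [sup E] by less than
   [e / 3], so [q] misses it by less than [e]. *)
have := P1 r (fine_chain_sub (fun x => @subIsetl _ _ _) rD).
have := P1 p (fine_chain_sub (fun x => @subIsetl _ _ _) pD).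
rewrite !ltr_norml ler_norml => /andP[? ?] /andP[? ?].
by apply/andP; split; lra.
Qed.

(** [min(u, v) = u - (u - v)^+], where [u - v <= u] provides the domination. *)
Lemma chain_integral_min u v A B : chain_integral u A -> chain_integral v B ->
  (forall x, 0 <= u x) -> (forall x, 0 <= v x) ->
  exists C, chain_integral (fun x => Num.min (u x) (v x)) C.
Proof.
move=> uA vB u0 v0.
have [|C wC] := chain_integral_pospart (chain_integralB uA vB) uA _ u0.
  by move=> x; rewrite gerBl.
exists (A - C).
rewrite (_ : (fun x => _) = fun x => u x - Num.max (u x - v x) 0).
  exact: chain_integralB.
by apply/funext => x; case: (lerP (u x) (v x)); case: (lerP (u x - v x) 0); lra.
Qed.

(** * Monotone convergence *)

Lemma nbhs_gauge_finI (D_ : nat -> K -> set K) (N : K -> nat) :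
  (forall k, nbhs_gauge (D_ k)) ->
  nbhs_gauge (fun t => [set y | forall k, (k < N t)%N -> D_ k t y]).
Proof.
move=> gD t; elim: (N t) => [|n IH]; first by apply: filterS filterT => y _ k.
apply: filterS (filterI (gD n t) IH) => y [/= yn yk] k.
by rewrite ltnS leq_eqVlt => /orP[/eqP->|/yk].
Qed.

Lemma chain_integral_monotone (u : nat -> K -> R) (A : nat -> R) v l :
  (forall k, chain_integral (u k) (A k)) ->
  (forall k x, u k x <= u k.+1 x) ->
  (forall x, u k x @[k --> \oo] --> v x) ->
  A k @[k --> \oo] --> l ->
  chain_integral v l.
Proof.
move=> uA und uv Al e e0.
pose V := G (line_max K) - G (line_min K).
have V0 : 0 <= V by rewrite subr_ge0 G_nd// line_min_le.
(* [e' * V] pays for stopping within [e'] of [v] at each tag; [4 * e'] covers [l - A m], the error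
   of [u m] and the total error of the increments. *)
pose e' := e / (V + 4).
have e'0 : 0 < e' by rewrite divr_gt0//; lra.
have e'E : e = e' * V + 4 * e' by rewrite /e'; field; lra.
have And k : A k <= A k.+1 by exact: chain_integral_le (uA k) (uA k.+1) _.
have Ale k : A k <= l.
  rewrite -(cvg_lim _ Al)//; apply: nondecreasing_cvgn_le; last exact: cvgP Al.
  exact/nondecreasing_seqP.
have uvle k x : u k x <= v x.
  rewrite -(cvg_lim _ (uv x))//.
  apply: (@nondecreasing_cvgn_le _ (fun k => u k x)); last exact: cvgP (uv x).
  exact/nondecreasing_seqP.
have [m mA] : exists m, l - A m < e'.
  have /cvgrPdist_lt/(_ _ e'0)[m _ /(_ m (leqnn m)) /=] := Al.
  by move=> /ltr_normlW; exists m.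
(* [N x] is a number of increments that brings [u m] within [e'] of [v] at [x]; only their gauges
   are imposed at the tag [x]. *)
have /choice[N NP] : forall x, exists n, v x - u (m + n)%N x < e'.
  move=> x.
  have /cvgrPdist_lt/(_ _ e'0)[n _ /(_ (m + n)%N (leq_addl m n)) /=] := uv x.
  by move=> /ltr_normlW; exists n.
have [D0 g0 P0] := uA m _ e'0.
pose w k x := u (m + k.+1)%N x - u (m + k)%N x.
have w0 k x : 0 <= w k x by rewrite subr_ge0 addnS.
pose B k := A (m + k.+1)%N - A (m + k)%N.
have wB k : chain_integral (w k) (B k) by exact: chain_integralB.
have /choice[D_ DP] : forall k, exists Dk, nbhs_gauge Dk /\
    forall s, fine_chain Dk (line_min K) s (line_max K) ->
      `|chain_sum (w k) (line_min K) s - B k| < e' / 2 ^+ k.+1.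
  move=> k.
  have [|D gD DP] := wB k (e' / 2 ^+ k.+1); last by exists D.
  by rewrite divr_gt0// exprn_gt0.
pose D t := D0 t `&` [set y | forall k, (k < N t)%N -> D_ k t y].
exists D.
  by apply: nbhs_gaugeI g0 _; apply: nbhs_gauge_finI => k; case: (DP k).
move=> s sD.
have := P0 s (fine_chain_sub (fun x => @subIsetl _ _ _) sD).
pose M := \max_(c <- s) N c.1.
have le0 : chain_sum (u m) (line_min K) s <= chain_sum v (line_min K) s.
  by apply: chain_sum_le sD _.
(* At a tag [t], the increments with [k < N t] telescope to [u (m + N t) - u m]; as [s] is finite,
   [M] bounds all these [k]. *)
have le1 : chain_sum (fun x => v x - u m x) (line_min K) s <=
    chain_sum (fun x => e' + \sum_(k < M) (if (k < N x)%N then w k x else 0))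
      (line_min K) s.
  apply: chain_sum_le sD _ => c cs /=.
  have NM : (N c.1 <= M)%N by rewrite /M; exact: leq_bigmax_seq.
  rewrite -big_mkcond/= -(big_ord_widen _ (fun k => w k c.1) NM).
  have -> : \sum_(k < N c.1) w k c.1 = u (m + N c.1)%N c.1 - u m c.1.
    rewrite -(big_mkord xpredT (fun k => w k c.1)).
    by rewrite (telescope_sumr (fun k => u (m + k)%N c.1))// addn0.
  by have := NP c.1; lra.
have le2 k : chain_sum (fun x => if (k < N x)%N then w k x else 0)
    (line_min K) s <= B k + e' / 2 ^+ k.+1.
  have [gk Pk] := DP k.
  have [t kt y [_]|s' s'D] := chain_sum_extend (D' := D_ k)
    (Q := fun x => (k < N x)%N) gk _ (w0 k) sD.
    exact.
  by have := Pk _ s'D; rewrite ltr_norml => /andP[? ?] ?; lra.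
have le3 : \sum_(k < M) (B k + e' / 2 ^+ k.+1) <= A (m + M)%N - A m + e'.
  have -> : \sum_(k < M) (B k + e' / 2 ^+ k.+1) =
      A (m + M)%N - A m + e' - e' / 2 ^+ M.
    elim: (M) => [|n IH]; first by rewrite big_ord0 addn0 expr0; lra.
    by rewrite big_ord_recr/= IH /B exprS; field; rewrite expf_neq0.
  by rewrite gerBl divr_ge0 ?exprn_ge0// ltW.
have le4 : \sum_(k < M) chain_sum (fun x => if (k < N x)%N then w k x else 0)
    (line_min K) s <= \sum_(k < M) (B k + e' / 2 ^+ k.+1).
  by apply: ler_sum => k _; exact: le2.
move: le1; rewrite chain_sumB chain_sumD chain_sum_sum (chain_sum_cst _ sD) -/V.
have := Ale (m + M)%N; have := Ale m.
rewrite !ltr_norml => ? ? ? /andP[? ?].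
by apply/andP; split; lra.
Qed.

Lemma chain_integral_monotone_bounded (u : nat -> K -> R) (A : nat -> R) v B :
  (forall k, chain_integral (u k) (A k)) ->
  (forall k x, u k x <= u k.+1 x) ->
  (forall x, u k x @[k --> \oo] --> v x) ->
  (forall k, A k <= B) ->
  exists2 l, chain_integral v l & A k @[k --> \oo] --> l.
Proof.
move=> uA und uv AB.
have Acvg : A k @[k --> \oo] --> limn A.
  apply: nondecreasing_is_cvgn; last by exists B => _ [k _ <-].
  apply/nondecreasing_seqP => k.
  exact: chain_integral_le (uA k) (uA k.+1) _.
by exists (limn A) => //; exact: chain_integral_monotone Acvg.
Qed.

(** * Fatou's lemma and dominated convergence *)

Lemma chain_integral_fatou (u : nat -> K -> R) (A : nat -> R) f h B :
  (forall k, chain_integral (u k) (A k)) -> chain_integral h B ->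
  (forall k x, 0 <= u k x) -> (forall k x, u k x <= h x) ->
  (forall x, u k x @[k --> \oo] --> f x) ->
  exists2 l, chain_integral f l &
    forall e, 0 < e -> \forall k \near \oo, l - e < A k.
Proof.
move=> uA hB u0 uh uf.
(* [g m j] is the minimum of [u m], ..., [u (m + j)], so that its infimum [i m] over [j] is that of
   all [u k] with [k >= m]. *)
have [g [gZ gS]] : exists g : nat -> nat -> K -> R,
    (forall m, g m 0%N = u m) /\
    forall m j x, g m j.+1 x = Num.min (g m j x) (u (m + j.+1)%N x).
  by exists (fun m => fix g j := if j is j'.+1 then
    fun x => Num.min (g j' x) (u (m + j)%N x) else u m).
have g0 m j x : 0 <= g m j x.
  by elim: j => [|j IH]; rewrite ?gZ ?u0// gS le_min IH u0.
have gni m j x : g m j.+1 x <= g m j x by rewrite gS ge_min lexx.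
(* The indices from [m + 1] to [m + 1 + j] lie among those from [m] to [m + j + 1]; hence [i] will
   be nondecreasing in [m]. *)
have gshift m j x : g m j.+1 x <= g m.+1 j x.
  elim: j => [|j IH]; first by rewrite gS !gZ ge_min addn1 lexx orbT.
  by rewrite gS (gS m.+1) le_min !ge_min IH addSnnS lexx orbT.
have gP m j : exists C, chain_integral (g m j) C.
  elim: j => [|j [C gC]]; first by exists (A m); rewrite gZ.
  rewrite (_ : g m j.+1 = fun x => Num.min (g m j x) (u (m + j.+1)%N x)).
    exact: chain_integral_min gC (uA _) (g0 m j) (u0 _).
  by apply/funext => x; rewrite gS.
pose i m x := inf (range (fun j => g m j x)).
have ile m j x : i m x <= g m j x.
  by apply: ge_inf; [exists 0 => _ [k _ <-]|exists j].
have lei m x (y : R) : (forall j, y <= g m j x) -> y <= i m x.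
  move=> yg; apply: lb_le_inf; first by exists (g m 0%N x), 0%N.
  by move=> _ [j _ <-].
have gi m x : g m j x @[j --> \oo] --> i m x.
  apply: nonincreasing_cvgn; last by exists 0 => _ [k _ <-].
  exact/nonincreasing_seqP.
(* Monotone convergence for the negated minima, whose integrals are at most 0. *)
have /choice[C iC] : forall m, exists c : R, chain_integral (i m) c.
  move=> m; have /choice[c gc] := gP m.
  have [|j x|x|j|l il _] := @chain_integral_monotone_bounded
      (fun j x => - g m j x) (fun j => - c j) (fun x => - i m x) 0.
  - by move=> j; exact: chain_integralN.
  - by rewrite lerN2.
  - exact: cvgN (gi m x).
  - by rewrite oppr_le0; exact: chain_integral_le chain_integral0 (gc j) _.
  exists (- l); rewrite (_ : i m = fun x => - - i m x).
    exact: chain_integralN.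
  by apply/funext => x; rewrite opprK.
have iu m x : i m x <= u m x by rewrite -gZ.
have CA m : C m <= A m by exact: chain_integral_le (iC m) (uA m) (iu m).
have [m x|x|m|l fl Cl] := @chain_integral_monotone_bounded i C f B iC.
- by apply: lei => j; exact: le_trans (ile m j.+1 x) _.
(* Once all [u k x] with [k >= m] lie within [e] of [f x], so does their infimum [i m x]. *)
- apply/cvgrPdist_le => e e0.
  have /cvgrPdist_le/(_ _ e0)[M _ MP] := uf x.
  exists M => // m /= Mm.
  have fu k : (m <= k)%N -> f x - e <= u k x <= f x + e.
    by move=> mk; rewrite -ler_distlC; exact: MP (leq_trans Mm mk).
  have /andP[_ fum] := fu m (leqnn m).
  rewrite ler_distlC (le_trans (iu m x))// andbT.
  apply: lei; elim => [|j IH]; first by rewrite gZ; have /andP[] := fu m (leqnn m).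
  by rewrite gS le_min IH; have /andP[] := fu _ (leq_addr j.+1 m).
- by apply: chain_integral_le (iC m) hB _ => x; exact: le_trans (iu m x) _.
exists l => // e e0.
have /cvgrPdist_lt/(_ _ e0) := Cl; apply: filterS => m.
by rewrite ltr_norml => /andP[_ ?]; have := CA m; lra.
Qed.

(** Fatou for [u - g] bounds [A] below and Fatou for [h - u] bounds it above, eventually up to any
    [e]; uniqueness of the integral makes the two bounds agree. *)
Lemma chain_integral_dominated (u : nat -> K -> R) (A : nat -> R) f g h B1 B2 :
  (forall k, chain_integral (u k) (A k)) ->
  chain_integral g B1 -> chain_integral h B2 ->
  (forall k x, g x <= u k x <= h x) ->
  (forall x, u k x @[k --> \oo] --> f x) ->
  exists2 l, chain_integral f l & A k @[k --> \oo] --> l.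
Proof.
move=> uA gB hB guh uf.
have [||k x|k x|x|l1 fl1 l1P] := @chain_integral_fatou (fun k x => u k x - g x)
  (fun k => A k - B1) (fun x => f x - g x) (fun x => h x - g x) (B2 - B1).
- by move=> k; exact: chain_integralB.
- exact: chain_integralB.
- by rewrite subr_ge0; have /andP[] := guh k x.
- by rewrite lerD2r; have /andP[] := guh k x.
- by apply: cvgB; [exact: uf|exact: cvg_cst].
have [||k x|k x|x|l2 fl2 l2P] := @chain_integral_fatou (fun k x => h x - u k x)
  (fun k => B2 - A k) (fun x => h x - f x) (fun x => h x - g x) (B2 - B1).
- by move=> k; exact: chain_integralB.
- exact: chain_integralB.
- by rewrite subr_ge0; have /andP[] := guh k x.
- by rewrite lerD2l lerN2; have /andP[] := guh k x.
- by apply: cvgB; [exact: cvg_cst|exact: uf].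
have fl : chain_integral f (B2 - l2).
  rewrite (_ : f = fun x => h x - (h x - f x)); first exact: chain_integralB.
  by apply/funext => x; rewrite opprB addrC subrK.
have l12 : l1 = B2 - l2 - B1.
  by apply: chain_integral_unique fl1 _; exact: chain_integralB.
exists (B2 - l2) => //; apply/cvgrPdist_lt => e e0.
apply: filterS2 (l1P _ e0) (l2P _ e0) => k ? ?.
by rewrite ltr_norml; apply/andP; split; lra.
Qed.

(** * Translation between chains and partitions *)

Lemma fine_chain_mkseq D (x t : nat -> K) m n b :
  fine_chain D (x m) [seq (t i, x i.+1) | i <- iota m n] b <->
  x (m + n)%N = b /\ forall i, (m <= i < m + n)%N ->
    [/\ (x i <= t i)%O, (t i <= x i.+1)%O & [set` `]x i, x i.+1]] `<=` D (t i)].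
Proof.
elim: n m => [|n IH] m /=.
  by rewrite addn0; split=> [->|[]//]; split=> // i /andP[? ?]; lia.
rewrite -addSnnS; split=> [[mt tm mD /IH[xb xD]]|[xb xD]].
  split=> // i /andP[]; rewrite leq_eqVlt => /orP[/eqP<- //|mi ib].
  by apply: xD; rewrite mi.
have [|mt tm mD] := xD m; first by rewrite leqnn ltnS leq_addr.
split=> //; apply/IH; split=> // i /andP[mi ib].
by apply: xD; rewrite ltnW.
Qed.

Lemma chain_sum_mkseq f (x t : nat -> K) m n :
  chain_sum f (x m) [seq (t i, x i.+1) | i <- iota m n] =
  \sum_(m <= i < m + n) f (t i) * (G (x i.+1) - G (x i)).
Proof.
elim: n m => [|n IH] m /=; first by rewrite addn0 big_geq.
by rewrite IH -addSnnS [RHS]big_ltn// ltnS leq_addr.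
Qed.

(** The two integrals differ by the term at [line_min K], the same for all partitions. Interval
    gauges are neighbourhood gauges; conversely each neighbourhood contains an open interval around
    its point. *)
Lemma is_line_integralE f A : is_line_integral f G A <->
  chain_integral f (A - f (line_min K) * G (line_min K)).
Proof.
split=> fA e e0.
  have [delta gdelta deltaP] := fA e e0.
  exists (fun x => [set` delta x]).
    by move=> x; have [? ?] := gdelta x; exact: open_nbhs_nbhs.
  move=> s.
  (* The starting point is prepended, so [x i] and [x i.+1] are the ends of cell [i]; the default
     [line_max K] is never read there. *)
  pose x i := nth (line_max K) (line_min K :: unzip2 s) i.
  pose t i := nth (line_max K) (unzip1 s) i.
  have -> : s = [seq (t i, x i.+1) | i <- iota 0 (size s)].
    rewrite -[LHS](mkseq_nth (line_max K, line_max K)); apply/eq_in_map => i.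
    rewrite mem_iota /t /x/= add0n => si.
    by rewrite !(nth_map (line_max K, line_max K))// -surjective_pairing.
  rewrite -[line_min K]/(x 0%N) => /fine_chain_mkseq[xb xD].
  have xt i : (i < size s)%N -> (x i <= t i)%O /\ (t i <= x i.+1)%O.
    by move=> si; have [] := xD i si.
  pose P := @LinePartition d K (size s) x t erefl xb xt.
  have := deltaP P; rewrite /riemann_sum chain_sum_mkseq add0n big_mkord /=.
  rewrite opprB addrA [X in `|X - _|]addrC; apply => i si.
  by have [] := xD i si.
have [D gD DP] := fA e e0.
have /choice[delta deltaP] : forall x, exists i : interval K,
    (open [set` i] /\ x \in i) /\ [set` i] `<=` D x.
  by move=> x; have [i ? ?] := nbhs_open_itv (gD x); exists i.
exists delta; first by move=> x; have [] := deltaP x.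
move=> P Pdelta; rewrite /riemann_sum.
have := DP [seq (Defs.tag P i, div_pt P i.+1) | i <- iota 0 (size_part P)].
rewrite -{1 2}(div_pt_first P) chain_sum_mkseq add0n big_mkord.
rewrite opprB addrA [X in `|X - _|]addrC; apply.
apply/fine_chain_mkseq; split; first exact: div_pt_last.
move=> i /= iP; have [? ?] := div_pt_tag iP; split=> //.
by apply: subset_trans (Pdelta i iP) _; have [] := deltaP (Defs.tag P i).
Qed.

Lemma line_integralE f (a : R) : chain_integral f a ->
  line_integral f G = a + f (line_min K) * G (line_min K).
Proof.
move=> fa.
have fA : is_line_integral f G (a + f (line_min K) * G (line_min K)).
  by apply/is_line_integralE; rewrite addrK.
have /is_line_integralE/chain_integral_unique/(_ fa) <- :=
  getPex (ex_intro [set A | is_line_integral f G A] _ fA).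
by rewrite subrK.
Qed.

End ChainSums.

Theorem theorem5p3 (R : realType) (d : Order.disp_t) (K : compactLineType d)
    (G : K -> R)
    (G_nondecreasing : forall x y : K, (x <= y)%O -> G x <= G y)
    (G_positive : forall x : K, 0 < G x)
    (G_amenable : amenable G)
    (f_ : nat -> K -> R) (g h f : K -> R)
    (f_integrable : forall m : nat, line_integrable (f_ m) G)
    (g_integrable : line_integrable g G)
    (h_integrable : line_integrable h G)
    (f_bounds : forall (m : nat) (x : K), g x <= f_ m x <= h x)
    (f_cvg : forall x : K, f_ m x @[m --> \oo] --> f x) :
  line_integrable f G /\
  line_integral (f_ m) G @[m --> \oo] --> line_integral f G.
Proof.
have /choice[a fa] : forall m, exists a, chain_integral G (f_ m) a.
  move=> m; have [A /is_line_integralE fA] := f_integrable m.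
  by exists (A - f_ m (line_min K) * G (line_min K)).
have [Bg /is_line_integralE gB] := g_integrable.
have [Bh /is_line_integralE hB] := h_integrable.
have [l fl al] := chain_integral_dominated G_nondecreasing fa gB hB f_bounds f_cvg.
split.
  exists (l + f (line_min K) * G (line_min K)).
  by apply/is_line_integralE; rewrite addrK.
rewrite (line_integralE G_nondecreasing fl).
under eq_fun do rewrite (line_integralE G_nondecreasing (fa _)).
(* The terms at [line_min K] converge by pointwise convergence there. *)
by apply: cvgD al _; apply: cvgMl; exact: f_cvg.
Qed.
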